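(* As formal power series in $q$, \[\sum_{\pi\in\mathcal{D}} (-1)^{\lceil\mathcal{E}\rceil(\pi)} q^{\mathcal{O}(\pi)} = (-q;-q^2)_\infty = (-q;q^4)_\infty(q^3;q^4)_\infty,\] \[\sum_{\pi\in\mathcal{P}} (-1)^{\lceil\mathcal{E}\rceil(\pi)} q^{\mathcal{O}(\pi)} = \frac{1}{(-q^2;-q^2)_\infty} = \frac{1}{(-q^2;q^4)_\infty(q^4;q^4)_\infty}.\]
   Context: A partition $\pi=(\lambda_1,\lambda_2,\dots)$ is a finite non-increasing sequence of positive integers; the empty sequence is the unique partition of $0$. $\mathcal{P}$ is the set of all partitions, $\mathcal{D}$ the set of partitions into distinct parts. $\mathcal{O}(\pi)=\lambda_1+\lambda_3+\cdots$ and $\lceil\mathcal{E}\rceil(\pi)=\lceil\lambda_2/2\rceil+\lceil\lambda_4/2\rceil+\lceil\lambda_6/2\rceil+\cdots$. $(a;q)_\infty=\prod_{i\ge0}(1-aq^i)$. *)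

(* Defs.v *)
From HB Require Import structures.
From mathcomp Require Import all_boot all_order all_algebra.
From mathcomp Require Import boolp classical_sets functions cardinality fsbigop.

Set Implicit Arguments.
Unset Strict Implicit.
Unset Printing Implicit Defensive.

Import GRing.Theory.

Local Open Scope ring_scope.

(* Formal power series; [f n] is the coefficient of degree [n] of [f]. *)
Record fps (R : Type) := Fps { fps_coef :> nat -> R }.

Notation "{ 'fps' R }" := (fps R) (at level 0, format "{ 'fps'  R }").

HB.instance Definition _ (R : Type) := gen_eqMixin {fps R}.
HB.instance Definition _ (R : Type) := gen_choiceMixin {fps R}.

Lemma fpsP (R : Type) (f g : {fps R}) : (forall n, f n = g n) -> f = g.
Proof. by case: f => f; case: g => g /= /funext ->. Qed.

Section FpsRing.
Variable R : comNzRingType.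
Implicit Types f g h : {fps R}.

Definition fps0 : {fps R} := Fps (fun=> 0).
Definition fps1 : {fps R} := Fps (fun n => (n == 0%N)%:R).
Definition fps_opp f : {fps R} := Fps (fun n => - f n).
Definition fps_add f g : {fps R} := Fps (fun n => f n + g n).
Definition fps_mul f g : {fps R} :=
  Fps (fun n => \sum_(i < n.+1) f i * g (n - i)%N).

Fact fps_addA : associative fps_add.
Proof. by move=> f g h; apply: fpsP => n /=; rewrite addrA. Qed.
Fact fps_addC : commutative fps_add.
Proof. by move=> f g; apply: fpsP => n /=; rewrite addrC. Qed.
Fact fps_add0 : left_id fps0 fps_add.
Proof. by move=> f; apply: fpsP => n /=; rewrite add0r. Qed.
Fact fps_addN : left_inverse fps0 fps_opp fps_add.
Proof. by move=> f; apply: fpsP => n /=; rewrite addNr. Qed.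

HB.instance Definition _ :=
  GRing.isZmodule.Build {fps R} fps_addA fps_addC fps_add0 fps_addN.

Lemma fps_mul_trunc N f g n : (n < N)%N ->
  fps_mul f g n = ((\poly_(i < N) f i) * (\poly_(i < N) g i))`_n.
Proof.
move=> ltnN; rewrite coefM; apply: eq_bigr => i _.
by rewrite !coef_poly (leq_ltn_trans (leq_ord i)) // (leq_ltn_trans (leq_subr i n)).
Qed.

Fact fps_mulA : associative fps_mul.
Proof.
move=> f g h; apply: fpsP => n.
pose t k := \poly_(i < n.+1) k i : {poly R}.
have tE k i : (i <= n)%N -> k i = (t k)`_i by move=> le_in; rewrite coef_poly ltnS le_in.
transitivity ((t f * (t g * t h))`_n).
  rewrite coefM; apply: eq_bigr => i _.
  by rewrite (tE f) ?leq_ord // (@fps_mul_trunc n.+1) // ltnS leq_subr.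
rewrite mulrA coefM; apply: eq_bigr => i _.
by rewrite (tE h) ?leq_subr // (@fps_mul_trunc n.+1).
Qed.

Fact fps_mulC : commutative fps_mul.
Proof.
move=> f g; apply: fpsP => n.
by rewrite !(@fps_mul_trunc n.+1) // mulrC.
Qed.

Fact fps_mul1 : left_id fps1 fps_mul.
Proof.
move=> f; apply: fpsP => n; rewrite /= big_ord_recl /= mul1r subn0.
by rewrite big1 ?addr0 // => i _; rewrite mul0r.
Qed.

Fact fps_mulD : left_distributive fps_mul fps_add.
Proof.
move=> f g h; apply: fpsP => n /=; rewrite -big_split /=.
by apply: eq_bigr => i _; rewrite mulrDl.
Qed.

Fact fps1_neq0 : fps1 != 0.
Proof.
apply/eqP => /(congr1 (fun f : {fps R} => f 0%N)) /= /eqP.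
by rewrite oner_eq0.
Qed.

HB.instance Definition _ := GRing.Zmodule_isComNzRing.Build {fps R}
  fps_mulA fps_mulC fps_mul1 fps_mulD fps1_neq0.

Lemma fps_coef0 n : (0 : {fps R}) n = 0. Proof. by []. Qed.
Lemma fps_coef1 n : (1 : {fps R}) n = (n == 0%N)%:R. Proof. by []. Qed.
Lemma fps_coefN f n : (- f) n = - f n. Proof. by []. Qed.
Lemma fps_coefD f g n : (f + g) n = f n + g n. Proof. by []. Qed.
Lemma fps_coefM f g n : (f * g) n = \sum_(i < n.+1) f i * g (n - i)%N.
Proof. by []. Qed.

Definition fpsX : {fps R} := Fps (fun n => (n == 1%N)%:R).

Lemma fps_coefXM f n : (fpsX * f) n = if n is m.+1 then f m else 0.
Proof.
rewrite fps_coefM; case: n => [|n]; first by rewrite big_ord1 mul0r.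
rewrite !big_ord_recl /= mul0r mul1r add0r subSS subn0.
by rewrite big1 ?addr0 // => i _; rewrite mul0r.
Qed.

Lemma fps_coefXn m n : (fpsX ^+ m) n = (n == m)%:R.
Proof.
elim: m n => [|m IHm] n; first by rewrite expr0 fps_coef1.
by rewrite exprS fps_coefXM; case: n => [|n] //; rewrite IHm eqSS.
Qed.

Lemma fps_coefMXn f m n :
  (f * fpsX ^+ m) n = if (m <= n)%N then f (n - m)%N else 0.
Proof.
elim: m n => [|m IHm] n; first by rewrite expr0 mulr1 subn0.
rewrite exprS mulrCA fps_coefXM.
by case: n => [//|n]; rewrite IHm.
Qed.

End FpsRing.

Section FpsInverse.
Variable R : comUnitRingType.
Implicit Types f g : {fps R}.

(* The first [n] coefficients of the inverse of [f]. *)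
Fixpoint fps_inv_seq f n : seq R :=
  if n is m.+1 then
    let s := fps_inv_seq f m in
    rcons s ((f 0%N)^-1 * ((m == 0%N)%:R - \sum_(i < m) s`_i * f (m - i)%N))
  else [::].

Definition fps_unit : {pred {fps R}} := fun f => f 0%N \is a GRing.unit.
Definition fps_inv f : {fps R} :=
  if fps_unit f then Fps (fun n => (fps_inv_seq f n.+1)`_n) else f.

Lemma size_fps_inv_seq f n : size (fps_inv_seq f n) = n.
Proof. by elim: n => //= n IHn; rewrite size_rcons IHn. Qed.

Lemma nth_fps_inv_seq f m n : (m < n)%N ->
  (fps_inv_seq f n)`_m = (fps_inv_seq f m.+1)`_m.
Proof.
elim: n => // n IHn; rewrite ltnS leq_eqVlt => /predU1P[-> //|ltmn].
by rewrite [fps_inv_seq f n.+1]/= nth_rcons size_fps_inv_seq ltmn IHn.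
Qed.

Fact fps_mulVf : {in fps_unit, left_inverse (1 : {fps R}) fps_inv *%R}.
Proof.
move=> f Uf; apply: fpsP => n; rewrite fps_coefM /fps_inv.
have -> : fps_unit f by [].
rewrite big_ord_recr /= nth_rcons size_fps_inv_seq ltnn eqxx subnn.
rewrite mulrAC mulVr // mul1r.
rewrite (eq_bigr (fun i : 'I_n => (fps_inv_seq f n)`_i * f (n - i)%N)).
  by rewrite addrC subrK.
by move=> i _; congr (_ * _); rewrite (nth_fps_inv_seq f (ltn_ord i)).
Qed.

Fact fps_unitPl f g : g * f = 1 -> fps_unit f.
Proof.
move/(congr1 (fun h : {fps R} => h 0%N)).
rewrite fps_coefM big_ord1 subnn fps_coef1 /= => gf1.
by apply/unitrPr; exists (g 0%N); rewrite mulrC.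
Qed.

Fact fps_inv_out : {in [predC fps_unit], fps_inv =1 id}.
Proof. by move=> f /negbTE Uf; rewrite /fps_inv; case: ifP => // /(elimF idP Uf). Qed.

HB.instance Definition _ :=
  GRing.ComNzRing_hasMulInverse.Build {fps R} fps_mulVf fps_unitPl fps_inv_out.

Lemma fps_unitE f : (f \is a GRing.unit) = (f 0%N \is a GRing.unit).
Proof. by []. Qed.

End FpsInverse.

Section FpsLimits.
Variable R : comNzRingType.
Implicit Types (u : nat -> {fps R}) (f l a b : {fps R}).

(* Convergence for the 'X-adic topology over a discrete coefficient ring. *)
Definition fps_cvg u l : Prop :=
  forall n, exists N, forall m, (N <= m)%N -> u m n = l n.

(* Meaningful only when the sequence converges. *)
Definition fps_lim u : {fps R} := xget 0 [set l | fps_cvg u l]%classic.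

Lemma fps_cvg_lim u l : fps_cvg u l -> fps_lim u = l.
Proof.
move=> ul; apply: xget_subset1 => // f g uf ug; apply: fpsP => n.
have [M Mf] := uf n; have [N Ng] := ug n.
by rewrite -(Mf (maxn M N)) ?leq_maxl // (Ng (maxn M N)) ?leq_maxr.
Qed.

(* Meaningful only when, for each n, finitely many [f i] with [i] in [A] have a
   nonzero coefficient of degree n; see [fps_summable]. *)
Definition fps_sum (I : choiceType) (A : set I) (f : I -> {fps R}) : {fps R} :=
  Fps (fun n => \sum_(i \in A) f i n).

Definition fps_summable (I : choiceType) (A : set I) (f : I -> {fps R}) : Prop :=
  forall n, finite_set [set i | A i /\ f i n <> 0]%classic.

(* The q-Pochhammer symbol (a; b)_oo; it is meaningful when the constant
   coefficient of b is zero, see [qpoch_cvg]. *)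
Definition qpoch a b : {fps R} :=
  fps_lim (fun n => \prod_(i < n) (1 - a * b ^+ i)).

Lemma fps_coefX_eq0 b n m : b 0%N = 0 -> (m < n)%N -> (b ^+ n) m = 0.
Proof.
move=> b0; elim: n m => // n IHn m ltmn.
rewrite exprS fps_coefM big1 // => -[[|i] lti] _ /=; first by rewrite b0 mul0r.
by rewrite IHn ?mulr0 //; case: m ltmn lti => // m ltmn _;
   rewrite subSS (leq_ltn_trans (leq_subr _ _)).
Qed.

Lemma fps_coefMX_eq0 a b n m : b 0%N = 0 -> (m < n)%N -> (a * b ^+ n) m = 0.
Proof.
move=> b0 ltmn; rewrite fps_coefM big1 // => i _.
by rewrite fps_coefX_eq0 ?mulr0 // (leq_ltn_trans (leq_subr _ _)).
Qed.

Lemma qpoch_cvg a b : b 0%N = 0 ->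
  fps_cvg (fun n => \prod_(i < n) (1 - a * b ^+ i)) (qpoch a b).
Proof.
move=> b0; set u := fun n => _.
have uS n : u n.+1 = u n * (1 - a * b ^+ n) by rewrite /u big_ord_recr.
pose l : {fps R} := Fps (fun n => u n.+1 n).
have ul : fps_cvg u l.
  move=> n; exists n.+1 => m; elim: m => // m IHm.
  rewrite leq_eqVlt => /predU1P[<- //|ltnm].
  rewrite uS mulrBr mulr1 mulrA fps_coefD fps_coefN.
  by rewrite fps_coefMX_eq0 // subr0; apply: IHm.
by rewrite /qpoch (fps_cvg_lim ul).
Qed.

Lemma qpoch_coef0 a b : a 0%N = 0 -> b 0%N = 0 -> qpoch a b 0%N = 1.
Proof.
move=> a0 b0; have [N /(_ N (leqnn N)) <-] := qpoch_cvg a b0 0.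
elim: N => [|N IHN]; first by rewrite big_ord0.
have -> : \prod_(i < N.+1) (1 - a * b ^+ i) =
    \prod_(i < N) (1 - a * b ^+ i) * (1 - a * b ^+ N) by rewrite big_ord_recr.
rewrite fps_coefM big_ord1 subnn IHN mul1r.
by rewrite fps_coefD fps_coefN fps_coefM big_ord1 a0 mul0r subr0.
Qed.

End FpsLimits.

Lemma qpoch_unit (R : comUnitRingType) (a b : {fps R}) :
  a 0%N = 0 -> b 0%N = 0 -> qpoch a b \is a GRing.unit.
Proof. by move=> a0 b0; rewrite fps_unitE qpoch_coef0 ?unitr1. Qed.

Definition is_partition (s : seq nat) : bool := sorted geq s && all (ltn 0) s.

Definition partitions : set (seq nat) := [set s | is_partition s]%classic.
Definition distinct_partitions : set (seq nat) :=
  [set s | is_partition s && uniq s]%classic.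

(* The part lambda_i is [nth 0 s i.-1], so odd-indexed parts sit at even
   positions. *)
Definition oddsum (s : seq nat) : nat :=
  (\sum_(i < size s | ~~ odd i) nth 0 s i)%N.
Definition ceil_evensum (s : seq nat) : nat :=
  (\sum_(i < size s | odd i) uphalf (nth 0 s i))%N.

Lemma oddsum_cons2 x y s : oddsum [:: x, y & s] = (x + oddsum s)%N.
Proof.
rewrite /oddsum big_mkcond /= !big_ord_recl /= add0n; congr (_ + _)%N.
by rewrite [RHS]big_mkcond; apply: eq_bigr => i _; rewrite /= negbK.
Qed.

Lemma partition_bounds s : is_partition s ->
  (size s <= (oddsum s).*2)%N /\ all (geq (oddsum s)) s.
Proof.
have [n] := ubnP (size s); elim: n s => // n IHn [|x [|y s]] /=.
- by [].
- rewrite /is_partition /= andbT => _ x_gt0.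
  rewrite /oddsum big_mkcond /= big_ord1 /= leqnn; split=> //.
  by rewrite (leq_trans x_gt0) // -addnn leq_addr.
- rewrite ltnS => /ltnW ltsn /andP[/= /andP[leyx srt] /and3P[x_gt0 y_gt0 pos]].
  have [||IHs IHa] := IHn s; first by [].
    by rewrite /is_partition pos andbT (path_sorted srt).
  rewrite oddsum_cons2 doubleD; split.
    have x2 : (1.*2 <= x.*2)%N by rewrite leq_double.
    by rewrite -addn2 addnC leq_add.
  rewrite /= leq_addr (leq_trans leyx) ?leq_addr //=.
  by apply: sub_all IHa => z /= /leq_trans; apply; rewrite leq_addl.
Qed.

Lemma finite_partitions_oddsum n :
  finite_set [set s | is_partition s /\ oddsum s = n]%classic.
Proof.
pose f (t : {k : 'I_n.*2.+1 & k.-tuple 'I_n.+1}) : seq nat :=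
  map val (tagged t : seq _).
apply: (@sub_finite_set _ _ (f @` setT)%classic); last first.
  exact/finite_image/finite_finset.
move=> s [/= /partition_bounds[szs als] On].
rewrite On in szs als; have szs' : (size s < n.*2.+1)%N by [].
exists (Tagged (fun k : 'I_n.*2.+1 => k.-tuple 'I_n.+1)
  (@Tuple (Ordinal szs') _ (map inord s) (introT eqP (size_map _ _)))) => //.
rewrite /f /= -map_comp -[RHS]map_id; apply/eq_in_map => x /(allP als) /= lexn.
by rewrite inordK.
Qed.

Lemma partitions_summable (R : comNzRingType) (c : seq nat -> {fps R}) :
  fps_summable partitions (fun s => c s * fpsX R ^+ oddsum s).
Proof.
move=> n; have fin : finite_set
    (\bigcup_(k in `I_n.+1) [set s | is_partition s /\ oddsum s = k])%classic.
  by apply: bigcup_finite => [|k _]; [exact: finite_II|exact: finite_partitions_oddsum].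
apply: sub_finite_set fin => s [Ps]; rewrite fps_coefMXn.
by case: leqP => // leOn _; exists (oddsum s).
Qed.

Lemma distinct_partitions_summable (R : comNzRingType) (c : seq nat -> {fps R}) :
  fps_summable distinct_partitions (fun s => c s * fpsX R ^+ oddsum s).
Proof.
move=> n; apply: sub_finite_set (partitions_summable c n).
by move=> s [/= /andP[Ps _] nz].
Qed.

(* Main.v *)
Require Import Defs.
From HB Require Import structures.
From mathcomp Require Import all_boot all_order all_algebra.
From mathcomp Require Import boolp classical_sets functions cardinality fsbigop.
From mathcomp Require Import ring.

(** For distinct partitions with parts at most [n], let [A n] be the sum of the
weights of the theorem and [B n] the sum of the weights obtained by exchanging
the roles of odd-indexed and even-indexed parts. Splitting off a largest part
equal to [n + 1] exchanges the two roles, so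
  [A (n + 1) = A n + q^(n + 1) B n] and
  [B (n + 1) = B n + (-1)^ceil((n + 1) / 2) A n],
whence [B (2k + 1) = 0], [B (2k) = (-1)^k A (2k)] and
[A (2k + 2) = A (2k) (1 + (-1)^k q^(2k + 1))]. For all partitions the last terms
of the recurrences become [B (n + 1)] and [A (n + 1)]; the same relations for [B]
hold and [A (2k + 2) (1 + (-1)^k q^(2k + 2)) = A (2k)]. Let [k] go to infinity.
The product forms follow by separating the factors of even and odd index. *)

Import GRing.Theory.

Local Open Scope ring_scope.

(** * Infinite sums of power series, coefficient by coefficient *)

Section FpsSums.
Variables (R : comNzRingType) (I : choiceType).
Implicit Types (A B : set I) (f g : I -> {fps R}) (c : {fps R}).
Local Open Scope classical_set_scope.

Lemma sub_fps_summable {A B f} :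
  A `<=` B -> fps_summable B f -> fps_summable A f.
Proof.
move=> AB sB n; apply: sub_finite_set (sB n) => i [Ai fi].
by split=> //; exact: AB.
Qed.

(** Terms with zero coefficient of degree [n] do not count, so the index set can be replaced by one
    adapted to that single degree. *)
Lemma fps_sum_supp A S f n : S `<=` A ->
  (forall i, A i -> f i n <> 0 -> S i) ->
  fps_sum A f n = \sum_(i \in S) f i n.
Proof.
move=> SA suppS; rewrite /=; apply/esym/fsbig_widen => // i [Ai NSi] /=.
by apply: contra_notP NSi; exact: suppS.
Qed.

Lemma fps_sumU A B f : fps_summable A f -> fps_summable B f ->
  A `&` B `<=` set0 -> fps_sum (A `|` B) f = fps_sum A f + fps_sum B f.
Proof.
move=> sA sB AB0; apply: fpsP => n; rewrite fps_coefD.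
rewrite (@fps_sum_supp A [set i | A i /\ f i n <> 0])//; last by move=> i [].
rewrite (@fps_sum_supp B [set i | B i /\ f i n <> 0])//; last by move=> i [].
rewrite -fsbigU0; [|exact: sA|exact: sB|]; last first.
  by move=> i [[Ai _] [Bi _]]; exact: (AB0 i).
apply: fps_sum_supp => [i [[Ai _]|[Bi _]]|i [Ai|Bi] fi].
- by left.
- by right.
- by left.
- by right.
Qed.

Lemma fps_sumMl A f c : fps_summable A f ->
  fps_sum A (fun i => c * f i) = c * fps_sum A f.
Proof.
move=> sA; apply: fpsP => n.
(* Coefficient [n] of [c * f i] involves the coefficients of [f i] in all degrees up to [n]. This
   [S] gathers their supports, so one finite set serves every term of the convolution and the two
   sums can be exchanged. *)
pose S := \bigcup_(k in `I_n.+1) [set i | A i /\ f i k <> 0].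
have finS : finite_set S by apply: bigcup_finite => // k _; exact: sA.
have SA : S `<=` A by move=> i [k _ []].
have suppS k i : (k <= n)%N -> A i -> f i k <> 0 -> S i by move=> *; exists k.
rewrite (@fps_sum_supp A S)//; last first.
  move=> i Ai; apply: contra_notP => NSi; rewrite fps_coefM big1// => k _.
  have [->|/eqP fi] := eqVneq (f i (n - k)%N) 0; first by rewrite mulr0.
  by case: NSi; apply: suppS fi; rewrite ?leq_subr.
rewrite fsbig_finite//.
under eq_bigr do rewrite fps_coefM.
rewrite exchange_big fps_coefM; apply: eq_bigr => k _ /=.
rewrite -mulr_sumr -fsbig_finite//; congr (_ * _).
by rewrite -(@fps_sum_supp A S)// => i; apply: suppS; rewrite leq_subr.
Qed.

End FpsSums.

(** * Limits, and splitting a Pochhammer product by parity of the index *)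

Section FpsLimits.
Variable R : comNzRingType.
Implicit Types (u v : nat -> {fps R}) (f g a b : {fps R}).

Lemma fps_cvgM u v f g :
  fps_cvg u f -> fps_cvg v g -> fps_cvg (fun n => u n * v n) (f * g).
Proof.
move=> uf vg n.
(* Convergence gives one threshold per degree; the product needs a common one for all degrees up to
   [n]. *)
have [N HN] : exists N, forall m, (N <= m)%N ->
    forall k, (k <= n)%N -> u m k = f k /\ v m k = g k.
  elim: n => [|n [N IHN]]; [have [M HM] := uf 0%N; have [M' HM'] := vg 0%N
    | have [M HM] := uf n.+1; have [M' HM'] := vg n.+1].
    exists (maxn M M') => m; rewrite geq_max => /andP[mM mM'] k.
    by rewrite leqn0 => /eqP->; rewrite HM ?HM'.
  exists (maxn N (maxn M M')) => m; rewrite !geq_max => /and3P[mN mM mM'] k.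
  by rewrite leq_eqVlt => /predU1P[->|]; [rewrite HM ?HM'|exact: IHN].
exists N => m /HN Hm; rewrite !fps_coefM; apply: eq_bigr => k _.
by have [-> _] := Hm k (leq_ord k); have [_ ->] := Hm (n - k)%N (leq_subr _ _).
Qed.

Lemma fps_cvg_double u f : fps_cvg u f -> fps_cvg (fun n => u n.*2) f.
Proof.
move=> uf n; have [N HN] := uf n; exists N => m leNm.
by apply: HN; rewrite (leq_trans leNm)// -addnn leq_addr.
Qed.

Lemma fps_cvg_unique u f g : fps_cvg u f -> fps_cvg u g -> f = g.
Proof. by move=> /fps_cvg_lim <- /fps_cvg_lim <-. Qed.

(** The first [2n] factors on the left are exactly the first [n] factors of each product on the
    right. *)
Lemma qpoch_double a b : b 0%N = 0 ->
  qpoch a b = qpoch a (b ^+ 2) * qpoch (a * b) (b ^+ 2).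
Proof.
move=> b0; have b20 : (b ^+ 2) 0%N = 0 by apply: fps_coefX_eq0.
apply: fps_cvg_unique (fps_cvg_double _ _ (qpoch_cvg a b0)) _.
have := fps_cvgM _ _ _ _ (qpoch_cvg a b20) (qpoch_cvg (a * b) b20).
congr fps_cvg; apply/funext => n; elim: n => [|n IHn].
  by rewrite !big_ord0 mulr1.
rewrite doubleS !big_ord_recr /= -IHn -!exprM mul2n (exprS b n.*2).
by rewrite -!mulrA; congr (_ * _); rewrite mulrCA !mulrA.
Qed.

End FpsLimits.

(** * The two weights and the effect of a new first part *)

Section Weights.
Variable R : comNzRingType.
Implicit Types s : seq nat.
Local Open Scope classical_set_scope.
Local Notation q := (fpsX R).

Definition evensum s : nat := (\sum_(i < size s | odd i) nth 0 s i)%N.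
Definition ceil_oddsum s : nat :=
  (\sum_(i < size s | ~~ odd i) uphalf (nth 0 s i))%N.

Lemma oddsum_cons x s : oddsum (x :: s) = (x + evensum s)%N.
Proof.
rewrite /oddsum /evensum big_mkcond /= big_ord_recl /=; congr (_ + _)%N.
by rewrite [RHS]big_mkcond; apply: eq_bigr => i _; rewrite /= negbK.
Qed.

Lemma evensum_cons x s : evensum (x :: s) = oddsum s.
Proof.
rewrite /oddsum /evensum big_mkcond /= big_ord_recl /= add0n.
by rewrite [RHS]big_mkcond.
Qed.

Lemma ceil_oddsum_cons x s :
  ceil_oddsum (x :: s) = (uphalf x + ceil_evensum s)%N.
Proof.
rewrite /ceil_oddsum /ceil_evensum big_mkcond /= big_ord_recl /=.
congr (_ + _)%N.
by rewrite [RHS]big_mkcond; apply: eq_bigr => i _; rewrite /= negbK.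
Qed.

Lemma ceil_evensum_cons x s : ceil_evensum (x :: s) = ceil_oddsum s.
Proof.
rewrite /ceil_oddsum /ceil_evensum big_mkcond /= big_ord_recl /= add0n.
by rewrite [RHS]big_mkcond.
Qed.

Definition odd_weight s : {fps R} := (-1) ^+ ceil_evensum s * q ^+ oddsum s.
Definition even_weight s : {fps R} := (-1) ^+ ceil_oddsum s * q ^+ evensum s.

Lemma odd_weight_cons x s :
  odd_weight (x :: s) = q ^+ x * even_weight s.
Proof.
by rewrite /odd_weight /even_weight oddsum_cons ceil_evensum_cons exprD mulrCA.
Qed.

Lemma even_weight_cons x s :
  even_weight (x :: s) = (-1) ^+ uphalf x * odd_weight s.
Proof.
by rewrite /odd_weight /even_weight evensum_cons ceil_oddsum_cons exprD mulrA.
Qed.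

(** * Partitions with bounded parts *)

Definition parts_le (n : nat) : set (seq nat) := [set s | all (geq n) s].

Lemma is_partition_cons x s :
  is_partition (x :: s) = [&& (0 < x)%N, all (geq x) s & is_partition s].
Proof.
rewrite /is_partition /= path_sortedE; last first.
  by move=> ? ? ? /= /[swap]; exact: leq_trans.
by rewrite andbCA -!andbA.
Qed.

Lemma odd_weight_summable : fps_summable partitions odd_weight.
Proof. exact: partitions_summable. Qed.

(** The even sum ignores the first part, so the bound on the parts is what leaves finitely many
    choices for it; the even sum of the whole is the odd sum of the tail, which bounds the tail. *)
Lemma even_weight_summable n :
  fps_summable (partitions `&` parts_le n) even_weight.
Proof.
move=> m.
have finF : finite_set ([set [::]] `|` \bigcup_(x in `I_n.+1)
    (cons x @` [set s | is_partition s /\ (oddsum s <= m)%N])).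
  rewrite finite_setU; split; first exact: finite_set1.
  apply: bigcup_finite => // x _; apply: finite_image.
  rewrite (_ : mkset _ =
     \bigcup_(k in `I_m.+1) [set s | is_partition s /\ oddsum s = k]).
    by apply: bigcup_finite => // k _; exact: finite_partitions_oddsum.
  apply/seteqP; split=> [s [ps sm]|s [k km [ps sk]]].
    by exists (oddsum s).
  by split=> //; rewrite sk.
apply: sub_finite_set finF => -[|x s] [[Ps sn]]; first by left.
have /andP[xn _] := sn.
rewrite /even_weight fps_coefMXn evensum_cons; case: leqP => // leOm _; right.
exists x => //; exists s => //; split=> //.
by move: Ps; rewrite /partitions /= is_partition_cons => /and3P[].
Qed.

Lemma fps_sum_consU (A B C : set (seq nat)) x (f g : seq nat -> {fps R}) c :
  C = A `|` cons x @` B -> (forall s, A s -> x \notin s) ->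
  (forall s, f (x :: s) = c * g s) -> fps_summable C f -> fps_summable B g ->
  fps_sum C f = fps_sum A f + c * fps_sum B g.
Proof.
move=> CE xA fg sC sB; rewrite CE fps_sumU; first 1 last.
- by apply: sub_fps_summable sC; rewrite CE => s; left.
- by apply: sub_fps_summable sC; rewrite CE => s; right.
- by move=> s [/xA + [t _ ts]]; rewrite -ts mem_head.
congr (_ + _); rewrite -fps_sumMl//; apply: fpsP => n /=.
rewrite fsbig_image; last by move=> s t _ _ [].
by apply: eq_fsbigr => s _; rewrite fg.
Qed.

Lemma parts_leS_notin n s : parts_le n s -> n.+1 \notin s.
Proof. by move=> /allP sn; apply/negP => /sn /=; rewrite ltnn. Qed.

Lemma parts_leW n s : parts_le n s -> parts_le n.+1 s.
Proof. by apply: sub_all => x /= /leqW. Qed.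

Lemma partition_parts_leS n s : is_partition s -> parts_le n.+1 s ->
  parts_le n s \/ exists t, s = n.+1 :: t.
Proof.
case: s => [|x s]; first by left.
rewrite is_partition_cons /parts_le /= => /and3P[_ sx _] /andP[].
rewrite leq_eqVlt => /predU1P[-> _|xn _]; first by right; exists s.
left; rewrite -ltnS xn; apply: sub_all sx => y /= yx.
by rewrite -ltnS (leq_ltn_trans yx).
Qed.

(** The tail after a part [n.+1] may contain [n.+1] again, so its bound stays. *)
Lemma partitions_parts_leS n : partitions `&` parts_le n.+1 =
  partitions `&` parts_le n `|` cons n.+1 @` (partitions `&` parts_le n.+1).
Proof.
apply/seteqP; split=> s.
  move=> [Ps sn].
  have [sn'|[t st]] := partition_parts_leS _ _ Ps sn; first by left.
  right; exists t => //; move: Ps sn; rewrite st /partitions /parts_le /=.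
  by rewrite is_partition_cons => /and3P[_ _ ?] /andP[].
move=> [[Ps /parts_leW sn]//|[t [Pt tn] <-]].
split; last by rewrite /parts_le /= leqnn.
by rewrite /partitions /= is_partition_cons; apply/and3P.
Qed.

(** Here distinctness lowers the bound on the tail to [n]. *)
Lemma distinct_parts_leS n : distinct_partitions `&` parts_le n.+1 =
  distinct_partitions `&` parts_le n `|`
  cons n.+1 @` (distinct_partitions `&` parts_le n).
Proof.
apply/seteqP; split=> s.
  move=> [/andP[Ps us] sn].
  have [sn'|[t st]] := partition_parts_leS _ _ Ps sn.
    by left; split=> //; apply/andP.
  right; exists t => //; move: Ps us sn; rewrite st /=.
  rewrite is_partition_cons => /and3P[_ _ Pt] /andP[nt ut] /andP[_ tn].
  split; first exact/andP.
  apply/allP => y yt /=; have /= := allP tn y yt.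
  by rewrite leq_eqVlt => /predU1P[yn|]; first by rewrite -yn yt in nt.
move=> [[Ds /parts_leW sn]//|[t [/andP[Pt ut] tn] <-]].
have tn' := parts_leW _ _ tn.
split; last by rewrite /parts_le /= leqnn.
by apply/andP; split; [rewrite is_partition_cons; apply/and3P
                      | rewrite /= parts_leS_notin].
Qed.

Lemma distinct_partitionsW : distinct_partitions `<=` partitions.
Proof. by move=> s /andP[]. Qed.

(** * Sums over bounded parts and their recurrences *)

Definition odd_sum_le (A : set (seq nat)) n : {fps R} :=
  fps_sum (A `&` parts_le n) odd_weight.
Definition even_sum_le (A : set (seq nat)) n : {fps R} :=
  fps_sum (A `&` parts_le n) even_weight.

Lemma odd_summable_le (A : set (seq nat)) n :
  A `<=` partitions -> fps_summable (A `&` parts_le n) odd_weight.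
Proof.
by move=> AP; apply: sub_fps_summable odd_weight_summable => s [/AP].
Qed.

Lemma even_summable_le (A : set (seq nat)) n :
  A `<=` partitions -> fps_summable (A `&` parts_le n) even_weight.
Proof.
by move=> AP; apply: sub_fps_summable (even_weight_summable n) => s [/AP].
Qed.

(** The bound [m] on the tail covers both families: [n] for distinct parts, [n.+1] for all
    partitions. *)
Lemma sum_leS (A : set (seq nat)) n m : A `<=` partitions ->
  A `&` parts_le n.+1 = A `&` parts_le n `|` cons n.+1 @` (A `&` parts_le m) ->
  odd_sum_le A n.+1 = odd_sum_le A n + q ^+ n.+1 * even_sum_le A m /\
  even_sum_le A n.+1 =
    even_sum_le A n + (-1) ^+ uphalf n.+1 * odd_sum_le A m.
Proof.
move=> AP AE; split; apply: fps_sum_consU AE _ _ _ _.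
- by move=> s [_ /parts_leS_notin].
- exact: odd_weight_cons.
- exact: odd_summable_le.
- exact: even_summable_le.
- by move=> s [_ /parts_leS_notin].
- exact: even_weight_cons.
- exact: even_summable_le.
- exact: odd_summable_le.
Qed.

Lemma fps_sum_nil (A : set (seq nat)) (f : seq nat -> {fps R}) :
  A `<=` partitions -> A [::] -> fps_sum (A `&` parts_le 0) f = f [::].
Proof.
move=> AP A0; rewrite (_ : _ `&` _ = [set [::]]).
  by apply: fpsP => n /=; rewrite fsbig_set1.
apply/seteqP; split=> [[|x s]|_ ->]//.
by move=> [/AP /andP[_ /= /andP[+ _]] /andP[/=]]; case: x.
Qed.

Lemma odd_sum_le0 (A : set (seq nat)) :
  A `<=` partitions -> A [::] -> odd_sum_le A 0 = 1.
Proof.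
move=> AP A0; rewrite /odd_sum_le fps_sum_nil// /odd_weight /ceil_evensum.
by rewrite /oddsum !big_ord0 mulr1.
Qed.

Lemma even_sum_le0 (A : set (seq nat)) :
  A `<=` partitions -> A [::] -> even_sum_le A 0 = 1.
Proof.
move=> AP A0; rewrite /even_sum_le fps_sum_nil// /even_weight /ceil_oddsum.
by rewrite /evensum !big_ord0 mulr1.
Qed.

(** No part exceeds the odd sum, so coefficient [n] is already final once parts up to [n] are
    allowed. *)
Lemma odd_sum_le_cvg (A : set (seq nat)) : A `<=` partitions ->
  fps_cvg (odd_sum_le A) (fps_sum A odd_weight).
Proof.
move=> AP n; exists n => m lenm.
rewrite [RHS](@fps_sum_supp _ _ _ (A `&` parts_le m))// => s As.
rewrite /odd_weight fps_coefMXn; case: leqP => // leOn _; split=> //.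
have [_] := partition_bounds (AP s As); apply: sub_all => x /= xO.
by rewrite (leq_trans xO)// (leq_trans leOn).
Qed.

(** * Closed forms of the bounded sums *)

Lemma expr_oppX2 k : (- q ^+ 2) ^+ k = (-1) ^+ k * q ^+ k.*2.
Proof. by rewrite (exprNn (q ^+ 2)) -exprM mul2n. Qed.

Lemma distinct_sum_le k :
  odd_sum_le distinct_partitions k.*2 =
    \prod_(i < k) (1 - (- q) * (- q ^+ 2) ^+ i) /\
  even_sum_le distinct_partitions k.*2 =
    (-1) ^+ k * odd_sum_le distinct_partitions k.*2.
Proof.
elim: k => [|k [IHo IHe]].
  have DP := distinct_partitionsW.
  by rewrite odd_sum_le0// even_sum_le0// big_ord0 mulr1.
rewrite doubleS.
have [o1 e1] := sum_leS _ _ _ distinct_partitionsW (distinct_parts_leS k.*2).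
have [o2 e2] :=
  sum_leS _ _ _ distinct_partitionsW (distinct_parts_leS k.*2.+1).
(* The new sign is [(-1) ^+ k.+1], opposite to the one in [IHe], so the two terms cancel. *)
have e10 : even_sum_le distinct_partitions k.*2.+1 = 0.
  by rewrite e1 IHe uphalfE /= doubleK exprS; ring.
move: o2 e2; rewrite e10 mulr0 addr0 => o2 e2; split.
  rewrite o2 o1 IHe IHo big_ord_recr /= expr_oppX2 (exprS q k.*2).
  by set P := \prod_(i < k) _; ring.
by rewrite e2 o2 add0r -doubleS uphalf_double.
Qed.

End Weights.

(** The recurrences are now implicit, with the new sums on both sides, so each step solves a linear
    system; stating a product equal to 1 keeps inverses out of the induction. *)
Lemma partition_sum_le (R : comUnitRingType) k :
  let q := fpsX R in
  odd_sum_le R partitions k.*2 *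
    \prod_(i < k) (1 - (- q ^+ 2) * (- q ^+ 2) ^+ i) = 1 /\
  even_sum_le R partitions k.*2 = (-1) ^+ k * odd_sum_le R partitions k.*2.
Proof.
move=> q; elim: k => [|k [IHo IHe]].
  by rewrite odd_sum_le0// even_sum_le0// big_ord0 mulr1.
rewrite doubleS.
have [] := sum_leS R _ _ _ (@subset_refl _ _) (partitions_parts_leS k.*2.+1).
have [] := sum_leS R _ _ _ (@subset_refl _ _) (partitions_parts_leS k.*2).
move: IHo IHe.
set o := odd_sum_le _ _ k.*2; set o1 := odd_sum_le _ _ _.+1.
set e1 := even_sum_le _ _ k.*2.+1.
set o2 := odd_sum_le _ _ _.+2; set e2 := even_sum_le _ _ _.+2.
set P := \prod_(i < k) _ => oP -> o1E e1E.
have -> : uphalf k.*2.+2 = k.+1 by rewrite -doubleS uphalf_double.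
have uE : uphalf k.*2.+1 = k.+1 by rewrite uphalfE -doubleS doubleK.
rewrite uE in e1E => o2E e2E.
(* Eliminating [e1] gives [(o1 - o) * (1 + (-1) ^+ k * q ^+ k.*2.+1) = 0], whose second factor has
   constant coefficient 1. *)
have o1o : o1 = o.
  have U : 1 + (-1) ^+ k * q ^+ k.*2.+1 \is a GRing.unit.
    by rewrite fps_unitE fps_coefD fps_coefMXn /= addr0 unitr1.
  apply: (mulIr U); rewrite mulrDr mulr1 {1}o1E e1E (exprS _ k); ring.
have e10 : e1 = 0 by rewrite e1E o1o (exprS _ k); ring.
rewrite e10 add0r in e2E; split => //.
rewrite big_ord_recr /= -/P -[RHS]oP -o1o.
have -> : o1 = o2 * (1 - (- q ^+ 2) * (- q ^+ 2) ^+ k).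
  have -> : o1 = o2 - q ^+ k.*2.+2 * e2 by rewrite o2E addrK.
  by rewrite e2E expr_oppX2 !exprS; ring.
ring.
Qed.

Theorem theorem4p5 :
  let q := fpsX int in
  [/\ fps_sum distinct_partitions
        (fun p => (-1) ^+ ceil_evensum p * q ^+ oddsum p)
        = qpoch (- q) (- q ^+ 2),
      qpoch (- q) (- q ^+ 2)
        = qpoch (- q) (q ^+ 4) * qpoch (q ^+ 3) (q ^+ 4),
      fps_sum partitions
        (fun p => (-1) ^+ ceil_evensum p * q ^+ oddsum p)
        = 1 / qpoch (- q ^+ 2) (- q ^+ 2)
    & 1 / qpoch (- q ^+ 2) (- q ^+ 2)
        = 1 / (qpoch (- q ^+ 2) (q ^+ 4) * qpoch (q ^+ 4) (q ^+ 4))].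
Proof.
move=> q.
have q20 : (- q ^+ 2) 0%N = 0 by rewrite fps_coefN fps_coefXn oppr0.
have q4 : (- q ^+ 2) ^+ 2 = q ^+ 4 by ring.
have q3 : - q * - q ^+ 2 = q ^+ 3 by ring.
have q22 : - q ^+ 2 * - q ^+ 2 = q ^+ 4 by ring.
split.
(* The sum over parts at most [2k] equals the product of the first [k] factors, so the limits
   agree. *)
- have := fps_cvg_double _ _ _ (odd_sum_le_cvg int _ distinct_partitionsW).
  move/fps_cvg_unique; apply; have := qpoch_cvg (- q) q20.
  by congr fps_cvg; apply/funext => k; case: (distinct_sum_le int k).
- by rewrite (qpoch_double _ (- q) _ q20) q4 q3.
- have U : qpoch (- q ^+ 2) (- q ^+ 2) \is a GRing.unit by exact: qpoch_unit.
  apply: (mulIr U); rewrite divrK//.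
  (* Bounded sum times partial product is constantly 1, hence so is the product of the limits. *)
  have := fps_cvgM _ _ _ _ _ (fps_cvg_double _ _ _
    (odd_sum_le_cvg int partitions (@subset_refl _ _)))
    (qpoch_cvg (- q ^+ 2) q20).
  move/fps_cvg_unique; apply=> n; exists 0%N => k _.
  by case: (partition_sum_le int k) => ->.
- by rewrite (qpoch_double _ (- q ^+ 2) _ q20) q4 q22.
Qed.
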